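(* Let $0<\mu<1$, let $F$ be the fundamental matrix of a pair of images $I,J\subset\mathbb{R}^2$, let $\ell_1\subset\mathbb{R}^2$ be a directed epipolar line of the image $I$ and let $\ell_2\subset\mathbb{R}^2$ be a directed epipolar line of the image $J$. Then the set of all $\mu$-Bounded-Distortion planar affine transformations $f:\mathbb{R}^2\to\mathbb{R}^2$ that map the directed line $\ell_1$ to the directed line $\ell_2$ (preserving direction) is a convex subset of the (6-dimensional) real vector space of affine maps $\mathbb{R}^2\to\mathbb{R}^2$.
   Context: Every planar affine map $f:\mathbb{R}^2\to\mathbb{R}^2$ can be written uniquely as $f(\mathbf{x})=B\mathbf{x}+C\mathbf{x}+\mathbf{t}$ with $$B=\begin{pmatrix}a&b\\-b&a\end{pmatrix},\qquad C=\begin{pmatrix}c&d\\d&-c\end{pmatrix},\qquad \mathbf{t}\in\mathbb{R}^2,$$ where $a,b,c,d\in\mathbb{R}$ ($B$ is the similarity part, $C$ the anti-similarity part). For $B\neq 0$ define $$\mu_f=\frac{\|C\|}{\|B\|}=\sqrt{\frac{c^2+d^2}{a^2+b^2}},$$ with $\|\cdot\|$ the Frobenius norm. For a parameter $0<\mu<1$, the affine map $f$ is called $\mu$-Bounded-Distortion if $\mu_f\le\mu$. The fundamental matrix $F$ is a real $3\times 3$ matrix of rank 2 such that corresponding points $\mathbf{p}\in I$, $\mathbf{q}\in J$, written in homogeneous coordinates, satisfy $\mathbf{q}^TF\mathbf{p}=0$. The epipoles are the projective points $\mathbf{e}$ (for $I$) and $\mathbf{e}'$ (for $J$) spanning the kernels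 of $F$ and $F^T$, respectively (they may lie at infinity). An epipolar line of $I$ (respectively $J$) is a line in the affine plane $\mathbb{R}^2$ whose projective closure passes through $\mathbf{e}$ (respectively $\mathbf{e}'$). A directed line is a line $\ell=\{\mathbf{p}+s\mathbf{u}: s\in\mathbb{R}\}$ in $\mathbb{R}^2$ together with a choice of direction, given by a direction vector $\mathbf{u}\ne 0$ up to positive scaling. An affine map $f$ maps a directed line $\ell_1$ (with direction $\mathbf{u}_1$) to a directed line $\ell_2$ (with direction $\mathbf{u}_2$) if $f(\ell_1)=\ell_2$ and direction is preserved, i.e. the linear part of $f$ sends $\mathbf{u}_1$ to a strictly positive multiple of $\mathbf{u}_2$. The vector space structure on affine maps is pointwise addition and scalar multiplication (equivalently, the coordinates $(a,b,c,d,\mathbf{t})$). *)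

(* Defs.v *)
From HB Require Import structures.
From mathcomp Require Import all_boot all_order all_algebra.
From mathcomp Require Import all_classical all_reals.
From mathcomp Require Import convex.
From mathcomp Require Import ring lra.

Set Implicit Arguments.
Unset Strict Implicit.
Unset Printing Implicit Defensive.

Import Order.TTheory GRing.Theory Num.Theory.

Local Open Scope classical_set_scope.
Local Open Scope ring_scope.

Section PlanarAffineMaps.
Variable R : realType.
Implicit Types (f g : 'cV[R]_2 -> 'cV[R]_2) (A B C : 'M[R]_2).

Definition is_affine f : Prop :=
  exists A (t : 'cV[R]_2), forall x, f x = A *m x + t.

Definition affine_pred : {pred 'cV[R]_2 -> 'cV[R]_2} := fun f => `[< is_affine f >].

Lemma affine_pred_submod : submod_closed affine_pred.
Proof.
split=> [|k f g /asboolP[A [t ft]] /asboolP[B [u gu]]]; apply/asboolP.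
  by exists 0, 0 => x; rewrite mul0mx addr0.
exists (k *: A + B), (k *: t + u) => x.
have -> : (k *: f + g) x = k *: f x + g x by [].
by rewrite ft gu scalerDr mulmxDl scalemxAl addrACA.
Qed.

HB.instance Definition _ :=
  GRing.isSubmodClosed.Build R ('cV[R]_2 -> 'cV[R]_2) affine_pred
    affine_pred_submod.

(* The vector space structure is inherited from the pointwise operations on
   functions; [dim_affmap] below shows that its dimension is 6. *)
Record affmap : Type := AffMap {
  affmap_fun :> 'cV[R]_2 -> 'cV[R]_2;
  _ : affmap_fun \in affine_pred
}.

HB.instance Definition _ := [isSub for affmap_fun].
HB.instance Definition _ := [Choice of affmap by <:].
HB.instance Definition _ := [SubChoice_isSubLmodule of affmap by <:].

Lemma affmap_linE (k : R) (g h : affmap) x : (k *: g + h) x = k *: g x + h x.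
Proof. by []. Qed.

Definition lin_part (f : affmap) : 'M[R]_2 :=
  \matrix_(i, j) (f (delta_mx j 0) - f 0) i 0.

Definition trans_part (f : affmap) : 'cV[R]_2 := f 0.

Lemma lin_partE f A (t : 'cV[R]_2) (fP : f \in affine_pred) :
  (forall x, f x = A *m x + t) -> lin_part (AffMap fP) = A.
Proof.
move=> fE; apply/matrixP=> i j; rewrite mxE /= !fE mulmx0 add0r addrK.
by rewrite -colE mxE.
Qed.

Lemma affmapE (h : affmap) x : h x = lin_part h *m x + trans_part h.
Proof.
case: h => f fP; have /asboolP[A [t fE]] := fP.
by rewrite (lin_partE fP fE) /trans_part /= !fE mulmx0 add0r.
Qed.

Definition mx22 (a b c d : R) : 'M[R]_2 :=
  \matrix_(i, j) if i == 0 then (if j == 0 then a else b)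
                 else (if j == 0 then c else d).

Definition sim_mx (a b : R) : 'M[R]_2 := mx22 a b (- b) a.

Definition antisim_mx (c d : R) : 'M[R]_2 := mx22 c d d (- c).

(* The coefficients a, b, c, d are obtained by solving
   [lin_part h = sim_mx a b + antisim_mx c d]; see [affmap_decomp] and
   [affmap_decomp_uniq]. *)
Definition sim_part (h : affmap) : 'M[R]_2 :=
  let A := lin_part h in sim_mx ((A 0 0 + A 1 1) / 2) ((A 0 1 - A 1 0) / 2).

Definition antisim_part (h : affmap) : 'M[R]_2 :=
  let A := lin_part h in antisim_mx ((A 0 0 - A 1 1) / 2) ((A 0 1 + A 1 0) / 2).

Lemma ord2P (P : 'I_2 -> Prop) : P 0 -> P 1 -> forall i, P i.
Proof.
move=> P0 P1 [[|[|//]] i2].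
  by rewrite (_ : Ordinal i2 = 0) //; apply/val_inj.
by rewrite (_ : Ordinal i2 = 1) //; apply/val_inj.
Qed.

Lemma affmap_decomp (h : affmap) x :
  h x = sim_part h *m x + antisim_part h *m x + trans_part h.
Proof.
rewrite affmapE -mulmxDl; congr (_ *m _ + _).
by apply/matrixP; apply: ord2P; apply: ord2P; rewrite !mxE /=; field.
Qed.

Lemma affmap_decomp_uniq (h : affmap) (a b c d : R) (t : 'cV[R]_2) :
  (forall x, h x = sim_mx a b *m x + antisim_mx c d *m x + t) ->
  [/\ sim_part h = sim_mx a b, antisim_part h = antisim_mx c d
    & trans_part h = t].
Proof.
move=> hE; have {}hE x : h x = (sim_mx a b + antisim_mx c d) *m x + t.
  by rewrite hE mulmxDl.
have t0 : trans_part h = t by rewrite /trans_part hE mulmx0 add0r.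
case: h hE t0 => f fP /= fE t0; split=> //;
  rewrite /sim_part /antisim_part (lin_partE fP fE);
  by apply/matrixP; apply: ord2P; apply: ord2P; rewrite !mxE /=; field.
Qed.

Definition frobenius (m n : nat) (A : 'M[R]_(m, n)) : R :=
  Num.sqrt (\sum_i \sum_j A i j ^+ 2).

Definition distortion (h : affmap) : R :=
  frobenius (antisim_part h) / frobenius (sim_part h).

Lemma distortionE (h : affmap) (a b c d : R) (t : 'cV[R]_2) :
  (forall x, h x = sim_mx a b *m x + antisim_mx c d *m x + t) ->
  distortion h = Num.sqrt ((c ^+ 2 + d ^+ 2) / (a ^+ 2 + b ^+ 2)).
Proof.
move=> /affmap_decomp_uniq[hB hC _].
have nB : frobenius (sim_mx a b) = Num.sqrt 2 * Num.sqrt (a ^+ 2 + b ^+ 2).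
  rewrite -sqrtrM // /frobenius !big_ord_recl !big_ord0 !mxE /=.
  by congr Num.sqrt; ring.
have nC : frobenius (antisim_mx c d) = Num.sqrt 2 * Num.sqrt (c ^+ 2 + d ^+ 2).
  rewrite -sqrtrM // /frobenius !big_ord_recl !big_ord0 !mxE /=.
  by congr Num.sqrt; ring.
rewrite /distortion hB hC nB nC -mulf_div divff ?mul1r; last first.
  by rewrite sqrtr_eq0 -ltNge.
by rewrite sqrtrM ?sqrtrV // addr_ge0 // sqr_ge0.
Qed.

Definition bounded_distortion (mu : R) (h : affmap) : Prop :=
  sim_part h != 0 /\ distortion h <= mu.

Definition affmap_coord (h : affmap) : 'rV[R]_6 :=
  row_mx (mxvec (lin_part h)) (trans_part h)^T : 'rV_(2 * 2 + 2).

Lemma affmap_coord_linear : linear affmap_coord.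
Proof.
move=> k g h; pose r (h' : affmap) : 'rV[R]_(2 * 2 + 2) :=
  row_mx (mxvec (lin_part h')) (trans_part h')^T.
suff : r (k *: g + h) = k *: r g + r h by [].
rewrite /r scale_row_mx add_row_mx; congr row_mx.
  rewrite -linearP; congr mxvec; apply/matrixP=> i j; rewrite !mxE /=.
  by ring.
by rewrite -linearP.
Qed.

Lemma affmap_coord_bij : bijective affmap_coord.
Proof.
pose A (w : 'rV[R]_6) : 'M[R]_2 := vec_mx (lsubmx (w : 'rV_(2 * 2 + 2))).
pose t (w : 'rV[R]_6) : 'cV[R]_2 := (rsubmx (w : 'rV_(2 * 2 + 2)))^T.
pose F w x := A w *m x + t w.
have FP w : F w \in affine_pred by apply/asboolP; exists (A w), (t w).
exists (fun w => AffMap (FP w)) => [h|w].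
  apply/val_inj/funext=> x /=; rewrite affmapE /F /A /t /affmap_coord.
  by rewrite row_mxKl row_mxKr mxvecK trmxK.
rewrite /affmap_coord (@lin_partE _ (A w) (t w)) // /trans_part /= /F.
by rewrite mulmx0 add0r vec_mxK trmxK (hsubmxK (w : 'rV_(2 * 2 + 2))).
Qed.

Lemma affmap_vect_axiom : Vector.axiom 6 affmap.
Proof.
exists affmap_coord; first exact: affmap_coord_linear.
exact: affmap_coord_bij.
Qed.

HB.instance Definition _ := Lmodule_hasFinDim.Build R affmap affmap_vect_axiom.

Lemma dim_affmap : \dim {: affmap} = 6.
Proof. by rewrite dimvf. Qed.

End PlanarAffineMaps.

Section DirectedLines.
Variable R : realType.

(* A representative of a directed line: base points on the same line and
   directions equal up to a positive factor give the same directed line, and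
   the notions below do not depend on the representative. *)
Record dline : Type := DLine {
  dl_point : 'cV[R]_2;
  dl_dir : 'cV[R]_2;
  dl_dir_neq0 : dl_dir != 0
}.

Definition line_set (l : dline) : set 'cV[R]_2 :=
  [set dl_point l + s *: dl_dir l | s in [set: R]].

Definition maps_dline (h : affmap R) (l1 l2 : dline) : Prop :=
  h @` line_set l1 = line_set l2 /\
  exists2 s : R, 0 < s & lin_part h *m dl_dir l1 = s *: dl_dir l2.

End DirectedLines.

Section EpipolarGeometry.
Variable R : realType.
Implicit Types (F : 'M[R]_3) (e : 'cV[R]_3) (l : dline R).

Definition homog (x : 'cV[R]_2) (w : R) : 'cV[R]_3 :=
  col_mx x (w%:M : 'cV_1) : 'cV_(2 + 1).

(* [M] is the set of pairs of corresponding points. *)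
Definition fundamental_matrix (I J : set 'cV[R]_2)
    (M : set ('cV[R]_2 * 'cV[R]_2)) F : Prop :=
  \rank F = 2%N /\
  forall p q, I p -> J q -> M (p, q) -> (homog q 1)^T *m F *m homog p 1 = 0.

(* Homogeneous coordinates of the epipole of the first image. The epipole of
   the second image is the one of [F^T]. *)
Definition is_epipole F e : Prop := e != 0 /\ F *m e = 0.

(* The projective closure of a line is spanned by one of its points and its
   point at infinity. *)
Definition proj_closure l : set 'cV[R]_3 :=
  [set e | exists r s : R,
     e = r *: homog (dl_point l) 1 + s *: homog (dl_dir l) 0].

Definition epipolar_line F l : Prop :=
  exists2 e, is_epipole F e & proj_closure l e.

End EpipolarGeometry.

(* Main.v *)
Require Import Defs.
From mathcomp Require Import all_boot all_order all_algebra.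
From mathcomp Require Import all_classical all_reals.
From mathcomp Require Import interval_inference convex.
From mathcomp Require Import ring lra.

Import Order.TTheory GRing.Theory Num.Theory.

Local Open Scope classical_set_scope.
Local Open Scope ring_scope.

(** Identify the plane with the complex numbers, so that the linear part of an
    affine map is [z |-> beta z + gamma conj(z)] and bounded distortion reads
    [|gamma| <= mu |beta|], [beta != 0]. If it sends the direction [u] to [s v],
    [s > 0], then [q = gamma conj(u) conj(v)] and [p = beta u conj(v)] have sum
    [s |v|^2], so the condition becomes [|q| <= mu |s |v|^2 - q|]. As [mu < 1],
    this is an Apollonius disc for [q] whose centre and radius are linear in
    [s]; hence it is a convex cone in [(s, q)]. *)

(** After expansion, [h1] and [h2] handle the square terms; the cross term, with coefficient
    [2 * k * l], is Cauchy-Schwarz in the plane. *)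
Lemma disc_cone_convex (R : realFieldType) (k l r1 r2 x1 x2 y1 y2 : R) :
  0 <= k -> 0 <= l -> 0 <= r1 -> 0 <= r2 ->
  x1 ^+ 2 + y1 ^+ 2 <= r1 ^+ 2 -> x2 ^+ 2 + y2 ^+ 2 <= r2 ^+ 2 ->
  (k * x1 + l * x2) ^+ 2 + (k * y1 + l * y2) ^+ 2 <= (k * r1 + l * r2) ^+ 2.
Proof.
move=> k0 l0 r10 r20 h1 h2.
have dot_le : x1 * x2 + y1 * y2 <= r1 * r2.
  have [neg|pos] := lerP (x1 * x2 + y1 * y2) 0.
    exact: le_trans neg (mulr_ge0 r10 r20).
  rewrite -(@ler_pXn2r _ 2) ?nnegrE ?mulr_ge0 ?(ltW pos) //.
  have lagrange : (x1 * x2 + y1 * y2) ^+ 2 =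
      (x1 ^+ 2 + y1 ^+ 2) * (x2 ^+ 2 + y2 ^+ 2) - (x1 * y2 - y1 * x2) ^+ 2.
    by ring.
  rewrite exprMn lagrange lerBlDr ler_wpDr ?sqr_ge0 // ler_pM //;
    by rewrite addr_ge0 ?sqr_ge0.
have H1 := ler_wpM2l (sqr_ge0 k) h1.
have H2 := ler_wpM2l (sqr_ge0 l) h2.
have H3 := ler_wpM2l (mulr_ge0 k0 l0) dot_le.
lra.
Qed.

Section BoundedDistortion.
Variable R : realType.
Implicit Types (h : affmap R) (u v : 'cV[R]_2) (l : dline R) (s mu : R).

Lemma lin_part_lin (k l : R) (g h : affmap R) :
  lin_part (k *: g + l *: h) = k *: lin_part g + l *: lin_part h.
Proof.
apply/matrixP=> i j.
have E x : affmap_fun (k *: g + l *: h) x = k *: g x + l *: h x by [].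
by rewrite [LHS]mxE !E !mxE; ring.
Qed.

Lemma cV2_sqnorm_gt0 v : v != 0 -> 0 < v 0 0 ^+ 2 + v 1 0 ^+ 2.
Proof.
move=> v0; rewrite lt_neqAle addr_ge0 ?sqr_ge0 // andbT eq_sym.
apply: contra v0; rewrite paddr_eq0 ?sqr_ge0 // !sqrf_eq0 => /andP[/eqP a /eqP b].
by apply/eqP/matrixP=> i j; rewrite (ord1 j) mxE; move: i; apply: ord2P.
Qed.

Lemma mulmx_cV2 (A : 'M[R]_2) u i : (A *m u) i 0 = A i 0 * u 0 0 + A i 1 * u 1 0.
Proof.
rewrite mxE !big_ord_recl big_ord0 addr0.
by congr (A i _ * u _ 0 + A i _ * u _ 0); apply/val_inj.
Qed.

(** Root and quotient are cleared here; the two sums of squares are [4 |beta|^2] and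
    [4 |gamma|^2]. *)
Lemma bounded_distortionP mu h : 0 <= mu ->
  let A := lin_part h in
  bounded_distortion mu h <->
  0 < (A 0 0 + A 1 1) ^+ 2 + (A 0 1 - A 1 0) ^+ 2 /\
  (A 0 0 - A 1 1) ^+ 2 + (A 0 1 + A 1 0) ^+ 2 <=
    mu ^+ 2 * ((A 0 0 + A 1 1) ^+ 2 + (A 0 1 - A 1 0) ^+ 2).
Proof.
move=> mu0 /=; rewrite /bounded_distortion (distortionE (affmap_decomp h)).
rewrite /sim_part; set A := lin_part h.
rewrite !expr_div_n -!mulrDl -mulf_div divff ?mulr1; last first.
  by rewrite invr_eq0 expf_neq0 // pnatr_eq0.
set S := _ ^+ 2 + (A 0 1 - A 1 0) ^+ 2.
set C := _ ^+ 2 + (A 0 1 + A 1 0) ^+ 2.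
have -> : (sim_mx ((A 0 0 + A 1 1) / 2) ((A 0 1 - A 1 0) / 2) != 0) = (0 < S).
  have S0 : 0 <= S by rewrite addr_ge0 ?sqr_ge0.
  rewrite lt_neqAle S0 andbT [0 == S]eq_sym; congr (~~ _).
  rewrite /S paddr_eq0 ?sqr_ge0 // !sqrf_eq0.
  apply/eqP/andP => [/matrixP E|[/eqP-> /eqP->]].
    have := E 0 0; have := E 0 1; rewrite !mxE /= => E1 E2.
    by split; apply/eqP; lra.
  by apply/matrixP; apply: ord2P; apply: ord2P; rewrite !mxE /= ?mul0r ?oppr0.
(* Since [C / 0] is [0], the equivalence can fail at [S = 0], hence the premise. *)
have leE : 0 < S -> (Num.sqrt (C / S) <= mu) = (C <= mu ^+ 2 * S).
  move=> S0; rewrite -{1}(ger0_norm mu0) -sqrtr_sqr ler_sqrt ?sqr_ge0 //.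
  by rewrite ler_pdivrMr.
by split=> -[S0]; rewrite leE.
Qed.

(* [gamma_re u v h] and [gamma_im u v h] are the real and imaginary parts of
   [2 gamma conj(u) conj(v)]. *)
Definition gamma_re u v h : R :=
  let A := lin_part h in
  (A 0 0 - A 1 1) * (u 0 0 * v 0 0 - u 1 0 * v 1 0) +
  (A 0 1 + A 1 0) * (u 0 0 * v 1 0 + u 1 0 * v 0 0).

Definition gamma_im u v h : R :=
  let A := lin_part h in
  (A 0 1 + A 1 0) * (u 0 0 * v 0 0 - u 1 0 * v 1 0) -
  (A 0 0 - A 1 1) * (u 0 0 * v 1 0 + u 1 0 * v 0 0).

Lemma gamma_re_lin u v (k l : R) (g h : affmap R) :
  gamma_re u v (k *: g + l *: h) = k * gamma_re u v g + l * gamma_re u v h.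
Proof. by rewrite /gamma_re lin_part_lin !mxE; ring. Qed.

Lemma gamma_im_lin u v (k l : R) (g h : affmap R) :
  gamma_im u v (k *: g + l *: h) = k * gamma_im u v g + l * gamma_im u v h.
Proof. by rewrite /gamma_im lin_part_lin !mxE; ring. Qed.

(** Square [|q| <= mu |p|], multiply by [1 - mu ^+ 2] and complete the square; avoiding division
    keeps every term linear in [(s, q)]. The non-convex condition [beta != 0] disappears because
    [s > 0] forces it on the disc. *)
Lemma bounded_distortion_disc mu h u v s : 0 < mu -> mu < 1 ->
  u != 0 -> v != 0 -> 0 < s -> lin_part h *m u = s *: v ->
  let N := v 0 0 ^+ 2 + v 1 0 ^+ 2 in
  bounded_distortion mu h <->
  ((1 - mu ^+ 2) * gamma_re u v h + 2 * mu ^+ 2 * N * s) ^+ 2 +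
  ((1 - mu ^+ 2) * gamma_im u v h) ^+ 2 <= (2 * mu * N * s) ^+ 2.
Proof.
move=> mu0 mu1 u0 v0 s0 huv N; rewrite (bounded_distortionP _ _ (ltW mu0)) /=.
have N0 : 0 < N by exact: cV2_sqnorm_gt0.
have := cV2_sqnorm_gt0 _ u0; set U := (X in 0 < X) => U0.
have e i : lin_part h i 0 * u 0 0 + lin_part h i 1 * u 1 0 = s * v i 0.
  by rewrite -mulmx_cV2 huv mxE.
have nu0 : 0 < 1 - mu ^+ 2 by rewrite subr_gt0 expr_lt1 // ltW.
set q1 := gamma_re u v h; set q2 := gamma_im u v h.
have [q1E q2E] : q1 = gamma_re u v h /\ q2 = gamma_im u v h by [].
move: (e 0) (e 1) q1 q2 q1E q2E; rewrite /gamma_re /gamma_im /=.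
set A := lin_part h => e0 e1 q1 q2 q1E q2E.
set S := _ ^+ 2 + (A 0 1 - A 1 0) ^+ 2.
set C := _ ^+ 2 + (A 0 1 + A 1 0) ^+ 2.
have qE : q1 ^+ 2 + q2 ^+ 2 = C * (U * N) by rewrite q1E q2E /C /U /N; ring.
have pE : (2 * N * s - q1) ^+ 2 + q2 ^+ 2 = S * (U * N).
  have -> : 2 * N * s = 2 * ((s * v 0 0) * v 0 0 + (s * v 1 0) * v 1 0).
    by rewrite /N; ring.
  (* The added zero is [-2 Im (s v conj(v))]. Once [s v] is rewritten as the image of [u], the right
     side becomes [-2 Im p]. *)
  have -> : q2 = q2 + 2 * ((s * v 0 0) * v 1 0 - (s * v 1 0) * v 0 0) by ring.
  by rewrite -e0 -e1 q1E q2E /S /U /N; ring.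
have UN0 : 0 < U * N by rewrite mulr_gt0.
have discE : ((1 - mu ^+ 2) * q1 + 2 * mu ^+ 2 * N * s) ^+ 2 +
    ((1 - mu ^+ 2) * q2) ^+ 2 - (2 * mu * N * s) ^+ 2 =
    (1 - mu ^+ 2) * (U * N) * (C - mu ^+ 2 * S).
  transitivity ((1 - mu ^+ 2) * (C * (U * N) - mu ^+ 2 * (S * (U * N)))).
    by rewrite -qE -pE; ring.
  by ring.
have -> : (((1 - mu ^+ 2) * q1 + 2 * mu ^+ 2 * N * s) ^+ 2 +
    ((1 - mu ^+ 2) * q2) ^+ 2 <= (2 * mu * N * s) ^+ 2) = (C <= mu ^+ 2 * S).
  by rewrite -subr_le0 discE pmulr_rle0 ?mulr_gt0 // subr_le0.
split=> [[]//|le]; split=> //.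
have S0 : 0 <= S by rewrite addr_ge0 ?sqr_ge0.
have C0 : 0 <= C by rewrite addr_ge0 ?sqr_ge0.
rewrite lt_neqAle S0 andbT; apply/eqP => SE.
(* If [beta = 0] then [gamma = 0] too, contradicting [p + q = s |v|^2 > 0]. *)
have CE : C = 0 by apply/le_anti; rewrite C0 (le_trans le) // -SE mulr0.
move: qE pE; rewrite CE -SE !mul0r => /eqP.
rewrite paddr_eq0 ?sqr_ge0 // !sqrf_eq0 => /andP[/eqP-> /eqP->].
move=> /eqP; rewrite subr0 expr0n addr0 sqrf_eq0.
by rewrite gt_eqF // !mulr_gt0.
Qed.

(** Equality of the images reduces to one incidence: on parameters [h] acts as [t |-> r + t * s], a
    bijection since [s] is nonzero. Both remaining conditions pass to convex combinations. *)
Lemma maps_dlineP h l1 l2 :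
  maps_dline h l1 l2 <->
  (exists r, h (dl_point l1) = dl_point l2 + r *: dl_dir l2) /\
  exists2 s, 0 < s & lin_part h *m dl_dir l1 = s *: dl_dir l2.
Proof.
split=> [[img dir]|[[r hr] [s s0 hs]]]; split=> //.
- have : line_set l2 (h (dl_point l1)).
    by rewrite -img; exists (dl_point l1) => //; exists 0; rewrite // scale0r addr0.
  by case=> r _ <-; exists r.
- have hE t : h (dl_point l1 + t *: dl_dir l1) =
      dl_point l2 + (r + t * s) *: dl_dir l2.
    rewrite affmapE mulmxDr -scalemxAr hs scalerA addrAC -affmapE hr.
    by rewrite scalerDl addrA.
  apply/seteqP; split=> [_ [_ [t _ <-] <-]|_ [t _ <-]].
    by exists (r + t * s).
  (* This parameter inverts [t |-> r + t * s]. *)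
  exists (dl_point l1 + ((t - r) / s) *: dl_dir l1); first by exists ((t - r) / s).
  by rewrite hE divfK ?gt_eqF // subrKC.
- by exists s.
Qed.

End BoundedDistortion.

Theorem corollary1 (R : realType) (mu : R) (I J : set 'cV[R]_2)
    (M : set ('cV[R]_2 * 'cV[R]_2)) (F : 'M[R]_3) (l1 l2 : dline R) :
  0 < mu -> mu < 1 ->
  fundamental_matrix I J M F ->
  epipolar_line F l1 ->
  epipolar_line F^T l2 ->
  convex_set (M := affmap R)
    [set h : affmap R | bounded_distortion mu h /\ maps_dline h l1 l2].
Proof.
move=> mu0 mu1 _ _ _; apply/convex_setW => f g.
rewrite !inE => -[bf /maps_dlineP[[r1 p1] [s1 s10 d1]]].
move=> [bg /maps_dlineP[[r2 p2] [s2 s20 d2]]] t t0 t1; rewrite inE.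
have -> : conv t f g = t%:num *: f + (1 - t%:num) *: g :> affmap R by [].
move: t%:num t0 t1 => k k0 k1; have {}k1 : 0 < 1 - k by rewrite subr_gt0.
(* The stretch factor depends on the map, so it is combined with the same weights; this is the
   coordinate [s] of the cone. *)
set h := _ + _; set s := k * s1 + (1 - k) * s2.
have s0 : 0 < s by rewrite addr_gt0 ?mulr_gt0.
have dh : lin_part h *m dl_dir l1 = s *: dl_dir l2.
  by rewrite lin_part_lin mulmxDl -!scalemxAl d1 d2 !scalerA -scalerDl.
have u0 := dl_dir_neq0 l1; have v0 := dl_dir_neq0 l2.
split; last first.
  apply/maps_dlineP; split; last by exists s.
  exists (k * r1 + (1 - k) * r2).
  have -> : h (dl_point l1) = k *: f (dl_point l1) + (1 - k) *: g (dl_point l1).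
    by [].
  by rewrite p1 p2 !scalerDr !scalerA addrACA -!scalerDl subrKC scale1r.
move: bf bg; rewrite (bounded_distortion_disc _ _ _ _ _ _ mu0 mu1 u0 v0 s10 d1).
rewrite (bounded_distortion_disc _ _ _ _ _ _ mu0 mu1 u0 v0 s20 d2).
rewrite (bounded_distortion_disc _ _ _ _ _ _ mu0 mu1 u0 v0 s0 dh).
have N0 := cV2_sqnorm_gt0 _ _ v0.
have r0 x : 0 < x -> 0 <= 2 * mu * (dl_dir l2 0 0 ^+ 2 + dl_dir l2 1 0 ^+ 2) * x.
  by move=> x0; rewrite ltW // !mulr_gt0.
move=> bf bg.
(* Both coordinates and the radius of the disc condition are linear in the map and its stretch
   factor, so the combined inequality is the one for [h] and [s]. *)
have := disc_cone_convex _ _ _ _ _ _ _ _ _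
  (ltW k0) (ltW k1) (r0 _ s10) (r0 _ s20) bf bg.
by rewrite gamma_re_lin gamma_im_lin /s; lra.
Qed.
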